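(* Let $\mathbb{F}$ be any field (of arbitrary characteristic) and let $\mathfrak{g}$ be a Lie algebra over $\mathbb{F}$ of arbitrary (possibly infinite) dimension which is perfect with zero center, i.e. $[\mathfrak{g},\mathfrak{g}]=\mathfrak{g}$ and $C(\mathfrak{g})=0$. Then: (i) The derivation algebra $\mathrm{Der}\,\mathfrak{g}$ is a complete Lie algebra. (ii) The holomorph $\mathfrak{h}(\mathfrak{g})$ is a complete Lie algebra if and only if the center of the outer derivation algebra of $\mathfrak{g}$ is zero, i.e. $C(\mathrm{Der}\,\mathfrak{g}/\mathrm{ad}_{\mathfrak{g}})=0$.
   Context: For a Lie algebra $L$ over $\mathbb{F}$, its center is $C(L)=\{x\in L \mid [x,L]=0\}$. A derivation of $L$ is an $\mathbb{F}$-linear map $d:L\to L$ with $d([x,y])=[d(x),y]+[x,d(y)]$ for all $x,y\in L$. The space $\mathrm{Der}\,L$ of all derivations is a Lie algebra under the commutator of linear maps, called the derivation algebra of $L$. Writing $\mathrm{ad}_x(y)=[x,y]$, the space $\mathrm{ad}_L=\{\mathrm{ad}_x\mid x\in L\}$ of inner derivations is an ideal of $\mathrm{Der}\,L$, and the quotient Lie algebra $\mathrm{Der}\,L/\mathrm{ad}_L$ is called the outer derivation algebra of $L$. A Lie algebra is called complete if its center is zero and all its derivations are inner. The holomorph $\mathfrak{h}(L)$ of $L$ is the vector space $L\oplus \mathrm{Der}\,L$ with the bracket $$[(x,d),(y,e)]=([x,y]+d(y)-e(x),\,[d,e])\quad\text{for } x,y\in L,\ d,e\in\mathrm{Der}\,L.$$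 *)

(* Defs.v *)
From HB Require Import structures.
From mathcomp Require Import all_boot all_algebra.
From mathcomp Require Import boolp classical_sets functions.

Set Implicit Arguments.
Unset Strict Implicit.
Unset Printing Implicit Defensive.

Import GRing.Theory.
Local Open Scope classical_set_scope.
Local Open Scope ring_scope.
Local Open Scope quotient_scope.

Reserved Notation "[ 'lie' x , y ]" (format "[ 'lie'  x ,  y ]").

(* The alternating law is imposed in the form [x, x] = 0, which is the right
   axiom in characteristic 2 as well. *)
HB.mixin Record Lmodule_isLieAlgebra (F : fieldType) L of GRing.Lmodule F L := {
  lieb : L -> L -> L;
  lieb_bilinear : bilinear_for *:%R *:%R lieb;
  liebb : forall x, lieb x x = 0;
  lieb_jacobi : forall x y z,
    lieb x (lieb y z) + lieb y (lieb z x) + lieb z (lieb x y) = 0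
}.

#[short(type="lieAlgType")]
HB.structure Definition LieAlgebra (F : fieldType) :=
  {L of GRing.Lmodule F L & Lmodule_isLieAlgebra F L}.

Notation "[ 'lie' x , y ]" := (lieb x y) : ring_scope.

(* Cancels opposite summands in a goal [sum = 0] over a zmodType. *)
Ltac zcancel :=
  rewrite ?opprD ?opprK -[LHS]addr0 -!addrA;
  repeat match goal with
  | |- context [- ?x] =>
      rewrite ?[in LHS](addrCA _ x) ?[in LHS](addrCA _ (- x)) ?addKr ?addNKr
  end.

Section LieTheory.
Variables (F : fieldType) (L : lieAlgType F).
Implicit Types (x y z : L) (a : F).

Lemma liebDl x y z : [lie x + y, z] = [lie x, z] + [lie y, z].
Proof. by have /= := (@lieb_bilinear F L).1 z 1 x y; rewrite !scale1r. Qed.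

Lemma liebDr x y z : [lie x, y + z] = [lie x, y] + [lie x, z].
Proof. by have /= := (@lieb_bilinear F L).2 x 1 y z; rewrite !scale1r. Qed.

Lemma lie0b x : [lie 0, x] = 0.
Proof. by apply: (addrI [lie 0, x]); rewrite -liebDl !addr0. Qed.

Lemma lieb0 x : [lie x, 0] = 0.
Proof. by apply: (addrI [lie x, 0]); rewrite -liebDr !addr0. Qed.

Lemma liebZl a x y : [lie a *: x, y] = a *: [lie x, y].
Proof. by have /= := (@lieb_bilinear F L).1 y a x 0; rewrite lie0b !addr0. Qed.

Lemma liebZr a x y : [lie x, a *: y] = a *: [lie x, y].
Proof. by have /= := (@lieb_bilinear F L).2 x a y 0; rewrite lieb0 !addr0. Qed.

Lemma liebNl x y : [lie - x, y] = - [lie x, y].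
Proof. by rewrite -scaleN1r liebZl scaleN1r. Qed.

Lemma liebNr x y : [lie x, - y] = - [lie x, y].
Proof. by rewrite -scaleN1r liebZr scaleN1r. Qed.

Lemma liebBl x y z : [lie x - y, z] = [lie x, z] - [lie y, z].
Proof. by rewrite liebDl liebNl. Qed.

Lemma liebBr x y z : [lie x, y - z] = [lie x, y] - [lie x, z].
Proof. by rewrite liebDr liebNr. Qed.

Lemma liebC x y : [lie x, y] = - [lie y, x].
Proof.
apply/eqP; rewrite -addr_eq0; apply/eqP.
by have := liebb (x + y); rewrite liebDl !liebDr !liebb add0r addr0.
Qed.

Lemma lieb_leibniz x y z :
  [lie x, [lie y, z]] = [lie [lie x, y], z] + [lie y, [lie x, z]].
Proof.
apply/eqP; rewrite -subr_eq0 -(lieb_jacobi x y z); apply/eqP.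
rewrite (liebC z x) (liebC [lie x, y] z) liebNr opprD opprK -addrA.
by congr (_ + _); rewrite addrC.
Qed.

End LieTheory.

Section LieNotions.
Variables (F : fieldType) (L : lieAlgType F).

Definition lie_center : set L := [set x | forall y, [lie x, y] = 0].

Definition lin_span (A : set L) : set L :=
  [set z | exists n (a : 'I_n -> F) (x : 'I_n -> L),
     (forall i, A (x i)) /\ z = \sum_(i < n) a i *: x i].

(* [L, L] is the linear span of the brackets, not merely their set. *)
Definition lie_derived : set L :=
  lin_span [set z | exists x y, z = [lie x, y]].

Definition lie_perfect : Prop := lie_derived = setT.

Definition is_derivation (d : L -> L) : Prop :=
  linear d /\ (forall x y, d [lie x, y] = [lie d x, y] + [lie x, d y]).

Definition derivation : {pred L -> L} := fun d => `[< is_derivation d >].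

End LieNotions.

Arguments lie_center {F} L.
Arguments lie_derived {F} L.
Arguments lie_perfect {F} L.
Arguments derivation {F} L.

Section Der.
Variables (F : fieldType) (L : lieAlgType F).

Lemma derivation_submod_closed : submod_closed (derivation L).
Proof.
split; first by apply/asboolP; split=> [a x y|x y];
  rewrite ?lie0b ?lieb0 ?scaler0 ?addr0.
move=> k d e /asboolP[dl dM] /asboolP[el eM]; apply/asboolP.
have deE u : (k *: d + e) u = k *: d u + e u by [].
split=> [a x y|x y]; rewrite !deE.
  by rewrite dl el !scalerDr !scalerA (mulrC k a) addrACA.
rewrite dM eM liebDl liebDr liebZl liebZr scalerDr.
exact: addrACA.
Qed.

HB.instance Definition _ :=
  GRing.isSubmodClosed.Build F (L -> L) (derivation L) derivation_submod_closed.

Record Der := MkDer {der_fun :> L -> L; _ : der_fun \in derivation L}.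

Arguments der_fun : simpl never.

HB.instance Definition _ := [isSub for der_fun].
HB.instance Definition _ := [Choice of Der by <:].
HB.instance Definition _ := [SubChoice_isSubLmodule of Der by <:].

Lemma der_linear (d : Der) : linear d.
Proof. by case: d => d dP; have /asboolP[] := dP. Qed.

HB.instance Definition _ (d : Der) :=
  GRing.isLinear.Build F L L *:%R (der_fun d) (der_linear d).

Lemma derM (d : Der) (x y : L) :
  d [lie x, y] = [lie d x, y] + [lie x, d y].
Proof. by case: d => d dP; have /asboolP[] := dP. Qed.

Lemma derP (d e : Der) : d =1 e -> d = e.
Proof. by move=> de; apply/val_inj/funext. Qed.

Lemma der_addE (d e : Der) x : (d + e) x = d x + e x. Proof. by []. Qed.
Lemma der_oppE (d : Der) x : (- d) x = - d x. Proof. by []. Qed.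
Lemma der_scaleE a (d : Der) x : (a *: d) x = a *: d x. Proof. by []. Qed.
Lemma der_0E x : (0 : Der) x = 0. Proof. by []. Qed.
Definition derE := (der_addE, der_oppE, der_scaleE, der_0E).

Lemma der_comm_subproof (d e : Der) :
  (fun x => d (e x) - e (d x)) \in derivation L.
Proof.
apply/asboolP; split=> [a x y|x y].
  by rewrite !linearP scalerDr addrACA.
rewrite !derM !raddfD /= !derM liebBl liebBr.
apply/eqP; rewrite -subr_eq0; apply/eqP; by zcancel.
Qed.

Definition der_comm (d e : Der) : Der := MkDer (der_comm_subproof d e).

Lemma der_commE (d e : Der) x : der_comm d e x = d (e x) - e (d x).
Proof. by []. Qed.

Lemma der_comm_bilinear : bilinear_for *:%R *:%R der_comm.
Proof.
split=> f a d e; apply: derP => x; rewrite !(derE, der_commE) linearP;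
  by rewrite scalerBr opprD addrACA.
Qed.

Lemma der_commdd d : der_comm d d = 0.
Proof. by apply: derP => x; rewrite der_commE subrr. Qed.

Lemma der_comm_jacobi d e f :
  der_comm d (der_comm e f) + der_comm e (der_comm f d)
    + der_comm f (der_comm d e) = 0.
Proof.
apply: derP => x; rewrite !(derE, der_commE) !raddfB /=.
by zcancel.
Qed.

HB.instance Definition _ := Lmodule_isLieAlgebra.Build F Der
  der_comm_bilinear der_commdd der_comm_jacobi.

Lemma der_liebE (d e : Der) x : [lie d, e] x = d (e x) - e (d x).
Proof. by []. Qed.

Lemma ad_subproof (x : L) : lieb x \in derivation L.
Proof.
apply/asboolP; split=> [a y z|y z]; last exact: lieb_leibniz.
by rewrite liebDr liebZr.
Qed.

Definition ad (x : L) : Der := MkDer (ad_subproof x).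

Lemma adE (x y : L) : ad x y = [lie x, y]. Proof. by []. Qed.

Definition inner : {pred Der} := fun d => `[< exists x, d = ad x >].

Definition lie_complete : Prop :=
  lie_center L = [set 0] /\ forall d : Der, d \in inner.

End Der.

Arguments Der {F} L.
Arguments inner {F} L.
Arguments lie_complete {F} L.

HB.mixin Record isLieIdeal (F : fieldType) (L : lieAlgType F) (I : {pred L}) := {
  lie_idealP : forall x y : L, y \in I -> [lie x, y] \in I
}.

#[short(type="lieIdeal")]
HB.structure Definition LieIdeal (F : fieldType) (L : lieAlgType F) :=
  {I of GRing.AddClosed L I & GRing.isScaleClosed F L I & isLieIdeal F L I}.

Lemma lie_ideal_oppr_closed (F : fieldType) (L : lieAlgType F)
  (I : lieIdeal L) : oppr_closed I.
Proof. by move=> x Ix; rewrite -scaleN1r rpredZ. Qed.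

HB.instance Definition _ (F : fieldType) (L : lieAlgType F) (I : lieIdeal L) :=
  GRing.isOppClosed.Build L (I : {pred L}) (@lie_ideal_oppr_closed F L I).

Section LieQuotient.
Variables (F : fieldType) (L : lieAlgType F) (I : lieIdeal L).

Definition lie_quot : Type := Quotient.quot I.
HB.instance Definition _ := GRing.Zmodule.on lie_quot.
HB.instance Definition _ := EqQuotient.on lie_quot.

Let qeqP (x y : L) : reflect (\pi_lie_quot x = \pi_lie_quot y) (x - y \in I).
Proof. by rewrite Quotient.idealrBE; exact: eqP. Qed.

Let piD (x y : L) : \pi_lie_quot (x + y) = \pi_lie_quot x + \pi_lie_quot y.
Proof. by rewrite raddfD. Qed.

Let reprI (x : L) : repr (\pi_lie_quot x) - x \in I.
Proof. by apply/qeqP; rewrite reprK. Qed.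

(* Both operations are computed on representatives; quot_scaleE and quot_liebE
   show that the result does not depend on them. *)
Definition quot_scale (a : F) (u : lie_quot) : lie_quot := \pi_lie_quot (a *: repr u).
Definition quot_lieb (u v : lie_quot) : lie_quot := \pi_lie_quot [lie repr u, repr v].

Lemma quot_scaleE a (x : L) :
  quot_scale a (\pi_lie_quot x) = \pi_lie_quot (a *: x).
Proof. by apply/qeqP; rewrite -scalerBr rpredZ. Qed.

Lemma quot_liebE (x y : L) :
  quot_lieb (\pi_lie_quot x) (\pi_lie_quot y) = \pi_lie_quot [lie x, y].
Proof.
apply/qeqP; set x' := repr _; set y' := repr _.
rewrite -(subrK [lie x', y] [lie x', y']) -addrA -liebBr -liebBl.
by apply: rpredD; last rewrite liebC rpredN; exact/lie_idealP/reprI.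
Qed.

Let quot_ind (P : lie_quot -> Prop) :
  (forall x, P (\pi_lie_quot x)) -> forall u, P u.
Proof. by move=> H u; rewrite -(reprK u). Qed.

Lemma quot_scaleA a b u : quot_scale a (quot_scale b u) = quot_scale (a * b) u.
Proof. by elim/quot_ind: u => x; rewrite !quot_scaleE scalerA. Qed.

Lemma quot_scale1 : left_id 1 quot_scale.
Proof. by elim/quot_ind=> x; rewrite quot_scaleE scale1r. Qed.

Lemma quot_scaleDr : right_distributive quot_scale +%R.
Proof.
move=> a; elim/quot_ind=> x; elim/quot_ind=> y.
by rewrite -piD !quot_scaleE -piD scalerDr.
Qed.

Lemma quot_scaleDl u : {morph quot_scale^~ u : a b / a + b}.
Proof.
by move=> a b; elim/quot_ind: u => x; rewrite !quot_scaleE -piD scalerDl.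
Qed.

HB.instance Definition _ := GRing.Zmodule_isLmodule.Build F lie_quot
  quot_scaleA quot_scale1 quot_scaleDr quot_scaleDl.

Lemma quot_lieb_bilinear : bilinear_for *:%R *:%R quot_lieb.
Proof.
have piZ a x : a *: \pi_lie_quot x = \pi_lie_quot (a *: x) := quot_scaleE a x.
split; elim/quot_ind=> z a; elim/quot_ind=> x; elim/quot_ind=> y.
  by rewrite /= piZ -piD !quot_liebE piZ -piD liebDl liebZl.
by rewrite /= piZ -piD !quot_liebE piZ -piD liebDr liebZr.
Qed.

Let pi0 : \pi_lie_quot (0 : L) = 0. Proof. exact: raddf0. Qed.

Lemma quot_liebb u : quot_lieb u u = 0.
Proof. by elim/quot_ind: u => x; rewrite quot_liebE liebb pi0. Qed.

Lemma quot_lieb_jacobi u v w :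
  quot_lieb u (quot_lieb v w) + quot_lieb v (quot_lieb w u)
    + quot_lieb w (quot_lieb u v) = 0.
Proof.
elim/quot_ind: u => x; elim/quot_ind: v => y; elim/quot_ind: w => z.
by rewrite !quot_liebE -!piD lieb_jacobi pi0.
Qed.

HB.instance Definition _ := Lmodule_isLieAlgebra.Build F lie_quot
  quot_lieb_bilinear quot_liebb quot_lieb_jacobi.

End LieQuotient.

Section OuterDer.
Variables (F : fieldType) (L : lieAlgType F).

Lemma inner_submod_closed : submod_closed (inner L).
Proof.
split.
  by apply/asboolP; exists 0; apply: derP => y; rewrite derE adE lie0b.
move=> a d e /asboolP[x ->] /asboolP[y ->]; apply/asboolP.
by exists (a *: x + y); apply: derP => z; rewrite !derE !adE liebDl liebZl.
Qed.

HB.instance Definition _ :=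
  GRing.isSubmodClosed.Build F (Der L) (inner L) inner_submod_closed.

Lemma inner_ideal (d e : Der L) : e \in inner L -> [lie d, e] \in inner L.
Proof.
move=> /asboolP[x ->]; apply/asboolP; exists (d x); apply: derP => y.
by rewrite der_liebE !adE derM addrK.
Qed.

HB.instance Definition _ :=
  isLieIdeal.Build F (Der L) (inner L) inner_ideal.

Definition OutDer : Type := lie_quot (inner L).
HB.instance Definition _ := LieAlgebra.on OutDer.

End OuterDer.

Arguments OutDer {F} L.

Section Holomorph.
Variables (F : fieldType) (L : lieAlgType F).

Definition holomorph : Type := (L * Der L)%type.
HB.instance Definition _ := GRing.Lmodule.copy holomorph (L * Der L)%type.

Definition holo_lieb (u v : holomorph) : holomorph :=
  ([lie u.1, v.1] + u.2 v.1 - v.2 u.1, [lie u.2, v.2]).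

Lemma holo_lieb_bilinear : bilinear_for *:%R *:%R holo_lieb.
Proof.
have E a (u v : holomorph) :
  a *: u + v = (a *: u.1 + v.1, a *: u.2 + v.2) by [].
split=> w a u v; rewrite !E; congr pair.
- rewrite -[X in _ = X]/(a *: ([lie u.1, w.1] + u.2 w.1 - w.2 u.1)
    + ([lie v.1, w.1] + v.2 w.1 - w.2 v.1)).
  by rewrite liebDl liebZl der_addE der_scaleE (linearP w.2) opprD !scalerDr
    scalerN (addrACA _ _ (a *: _)) [LHS]addrACA.
- by rewrite liebDl liebZl.
- rewrite -[X in _ = X]/(a *: ([lie w.1, u.1] + w.2 u.1 - u.2 w.1)
    + ([lie w.1, v.1] + w.2 v.1 - v.2 w.1)).
  by rewrite liebDr liebZr der_addE der_scaleE (linearP w.2) opprD !scalerDr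
    scalerN (addrACA _ _ (a *: _)) [LHS]addrACA.
- by rewrite liebDr liebZr.
Qed.

Lemma holo_liebb u : holo_lieb u u = 0.
Proof. by congr pair; rewrite /= !liebb ?add0r ?subrr. Qed.

Lemma holo_lieb_jacobi u v w :
  holo_lieb u (holo_lieb v w) + holo_lieb v (holo_lieb w u)
    + holo_lieb w (holo_lieb u v) = 0.
Proof.
case: u v w => [x d] [y e] [z f]; congr pair; last exact: lieb_jacobi.
pose t (x y z : L) (d e f : Der L) := [lie x, [lie y, z] + e z - f y]
  + d ([lie y, z] + e z - f y) - [lie e, f] x.
rewrite -[LHS]/(t x y z d e f + t y z x e f d + t z x y f d e) /t.
rewrite !der_liebE !liebBr !liebDr !raddfB !raddfD /= !derM.
rewrite (lieb_leibniz x y z) (liebC z x) liebNr (liebC z [lie x, y]).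
rewrite (liebC z (d y)) (liebC x (e z)) (liebC y (f x)).
by zcancel.
Qed.

HB.instance Definition _ := Lmodule_isLieAlgebra.Build F holomorph
  holo_lieb_bilinear holo_liebb holo_lieb_jacobi.

End Holomorph.

Arguments holomorph {F} L.

(* Main.v *)
From HB Require Import structures.
Require Import Defs.
From mathcomp Require Import all_boot all_algebra.
From mathcomp Require Import boolp classical_sets functions.

(** The map [(x, d) |-> (ad x + d, d)] identifies the holomorph of [g] with the
    fibre product of two copies of [Der g] over [OutDer g].  Both [Der g] and
    this fibre product contain copies of [g] as ideals (one, respectively two),
    which are stable under every derivation [D] because [g] is perfect.  The
    restriction of [D] to such a copy is a derivation [delta] of [g], and since
    [g] is centerless [D] is bracketing with [delta] in the corresponding
    component.  Hence derivations of [Der g] are inner, and those of the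
    holomorph are given by pairs [(delta1, delta2)] whose difference is central
    modulo [ad g]; such a pair is inner iff the difference lies in [ad g]. *)

Set Implicit Arguments.
Unset Strict Implicit.
Unset Printing Implicit Defensive.

Import GRing.Theory.
Local Open Scope classical_set_scope.
Local Open Scope ring_scope.
Local Open Scope quotient_scope.

Arguments der_fun : simpl never.

Lemma lie_center_eq0 (F : fieldType) (L : lieAlgType F) :
  (forall x : L, (forall y, [lie x, y] = 0) -> x = 0) ->
  lie_center L = [set 0].
Proof.
move=> L0; apply/seteqP; split=> [x /L0 //|x /= ->].
by move=> y; rewrite lie0b.
Qed.

Lemma lie_perfect_ind (F : fieldType) (L : lieAlgType F) :
  lie_perfect L -> forall P : L -> Prop, P 0 ->
  (forall a x y, P x -> P y -> P (a *: x + y)) ->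
  (forall x y, P [lie x, y]) -> forall x, P x.
Proof.
move=> Lperf P P0 Plin Plie x.
have : lie_derived L x by rewrite Lperf.
move=> [n [a [y [yP ->]]]].
elim/big_ind: _ => // [u v Pu Pv|i _]; first by rewrite -(scale1r u); exact: Plin.
by rewrite -[_ *: _]addr0; apply: Plin => //; have [u [v ->]] := yP i.
Qed.

(** * Derivations of a Lie algebra [M] containing a perfect [L] as an ideal *)

Section PerfectIdeal.
Variables (F : fieldType) (L M : lieAlgType F).
Hypothesis L_perfect : lie_perfect L.
Variables (iota : {linear L -> M}) (rho : M -> Der L).
Hypothesis iota_eq0 : forall x, iota x = 0 -> x = 0.
Hypothesis iotaM : forall x y, iota [lie x, y] = [lie iota x, iota y].
Hypothesis iota_rho : forall m x, [lie m, iota x] = iota (rho m x).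

Let iota_inj : injective iota.
Proof.
by move=> x y xy; apply/subr0_eq/iota_eq0; rewrite raddfB /= xy subrr.
Qed.

(** Brackets span [L], and the Leibniz rule sends a bracket of two elements of the ideal to brackets
    that each have one factor in the ideal. *)
Lemma der_perfect_ideal_stable (D : Der M) x : exists y, D (iota x) = iota y.
Proof.
elim/(lie_perfect_ind L_perfect): x => [|a x y [x' Ex] [y' Ey]|x y].
- by exists 0; rewrite !raddf0.
- by exists (a *: x' + y'); rewrite !linearP /= Ex Ey.
exists (rho (D (iota x)) y - rho (D (iota y)) x).
by rewrite iotaM derM (liebC (iota x)) !iota_rho raddfB.
Qed.

(** Here [delta] is the restriction of [D] to the ideal; the identity is the Leibniz rule for [D
    [lie m, iota x]], pulled back along [iota]. *)
Lemma der_perfect_ideal (D : Der M) :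
  exists delta : Der L, forall m, rho (D m) = [lie delta, rho m].
Proof.
have [f fE] := choice (der_perfect_ideal_stable D).
have f_der : f \in derivation L.
  apply/asboolP; split=> [a x y|x y]; apply: iota_inj.
    by rewrite -fE !linearP /= !fE.
  by rewrite -fE iotaM derM !fE raddfD /= !iotaM.
exists (MkDer f_der) => m; apply: derP => x; apply: iota_inj.
rewrite der_liebE raddfB /= -fE -!iota_rho -fE derM.
by rewrite addrK.
Qed.

End PerfectIdeal.

(** * The adjoint map and completeness of [Der g] *)

Section Ad.
Variables (F : fieldType) (L : lieAlgType F).

Lemma ad_is_linear : linear (@ad F L).
Proof. by move=> a x y; apply: derP => z; rewrite !derE !adE liebDl liebZl. Qed.

HB.instance Definition _ :=
  GRing.isLinear.Build F L (Der L) *:%R (@ad F L) ad_is_linear.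

Lemma adM (x y : L) : ad [lie x, y] = [lie ad x, ad y].
Proof.
by apply: derP => z; rewrite der_liebE !adE lieb_leibniz addrK.
Qed.

Lemma lieb_ad (d : Der L) x : [lie d, ad x] = ad (d x).
Proof. by apply: derP => y; rewrite der_liebE !adE derM addrK. Qed.

Hypothesis L_centerless : lie_center L = [set 0].

Lemma ad_eq0 (x : L) : ad x = 0 -> x = 0.
Proof.
move=> x0; have : lie_center L x by move=> y; rewrite -adE x0.
by rewrite L_centerless.
Qed.

Lemma ad_inj : injective (@ad F L).
Proof.
by move=> x y xy; apply/subr0_eq/ad_eq0; rewrite raddfB /= xy subrr.
Qed.

Lemma lie_center_Der : lie_center (Der L) = [set 0].
Proof.
apply: lie_center_eq0 => d dC; apply: derP => x; apply: ad_eq0.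
by rewrite -lieb_ad.
Qed.

End Ad.

Lemma lie_complete_Der (F : fieldType) (g : lieAlgType F) :
  lie_perfect g -> lie_center g = [set 0] -> lie_complete (Der g).
Proof.
move=> g_perfect g_centerless; split; first exact: lie_center_Der.
move=> D; apply/asboolP.
have [delta deltaE] := der_perfect_ideal (iota := @ad F g) (rho := id) g_perfect
  (ad_eq0 g_centerless) (@adM F g) (@lieb_ad F g) D.
by exists delta; apply: derP => d; rewrite adE -deltaE.
Qed.

(** * The holomorph inside [Der L * Der L] *)

Section Holomorph.
Variables (F : fieldType) (L : lieAlgType F).

Lemma holo_liebE (u v : holomorph L) :
  [lie u, v] = ([lie u.1, v.1] + u.2 v.1 - v.2 u.1, [lie u.2, v.2]).
Proof. by []. Qed.

(* [(rho1, snd)] is the embedding of the holomorph into [Der L * Der L];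
   [iota1] and [iota2] are the preimages of the two coordinate copies of
   [ad L]. *)
Definition holo_rho1 (u : holomorph L) : Der L := ad u.1 + u.2.
Definition holo_iota1 (x : L) : holomorph L := (x, 0).
Definition holo_iota2 (x : L) : holomorph L := (- x, ad x).

Lemma holo_iota1_is_linear : linear holo_iota1.
Proof. by move=> a x y; congr pair; rewrite /= scaler0 addr0. Qed.

HB.instance Definition _ :=
  GRing.isLinear.Build F L (holomorph L) *:%R holo_iota1 holo_iota1_is_linear.

Lemma holo_iota2_is_linear : linear holo_iota2.
Proof.
by move=> a x y; congr pair; rewrite /= ?linearP // opprD scalerN.
Qed.

HB.instance Definition _ :=
  GRing.isLinear.Build F L (holomorph L) *:%R holo_iota2 holo_iota2_is_linear.

Lemma holo_iota1M x y :
  holo_iota1 [lie x, y] = [lie holo_iota1 x, holo_iota1 y].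
Proof. by rewrite holo_liebE /= !derE addr0 subr0 lieb0. Qed.

Lemma holo_iota2M x y :
  holo_iota2 [lie x, y] = [lie holo_iota2 x, holo_iota2 y].
Proof.
rewrite holo_liebE /= -adM !adE liebNl !liebNr !opprK subrr add0r.
by rewrite [in RHS]liebC.
Qed.

Lemma holo_iota1_rho u x :
  [lie u, holo_iota1 x] = holo_iota1 (holo_rho1 u x).
Proof. by rewrite holo_liebE /= lieb0 !derE subr0. Qed.

Lemma holo_iota2_rho (u : holomorph L) x :
  [lie u, holo_iota2 x] = holo_iota2 (u.2 x).
Proof.
rewrite holo_liebE /= lieb_ad liebNr raddfN /= adE (liebC x) opprK.
by congr pair; rewrite addrAC addNr add0r.
Qed.

Lemma holo_rho1M (u v : holomorph L) :
  holo_rho1 [lie u, v] = [lie holo_rho1 u, holo_rho1 v].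
Proof.
rewrite /holo_rho1 holo_liebE /= raddfB raddfD /= adM -!lieb_ad.
rewrite liebDl !liebDr (liebC (ad u.1) v.2) addrA.
by congr (_ + _); rewrite addrAC.
Qed.

Hypothesis L_centerless : lie_center L = [set 0].

Lemma holo_rho_inj (u v : holomorph L) :
  holo_rho1 u = holo_rho1 v -> u.2 = v.2 -> u = v.
Proof.
case: u v => [x d] [y e] /= + de; rewrite /holo_rho1 /= de.
by move=> /addIr /(ad_inj L_centerless) ->.
Qed.

(** Bracketing [u] with the two ideal copies of [L] recovers both of its coordinates, [holo_rho1 u]
    and [u.2]. *)
Lemma lie_center_holomorph : lie_center (holomorph L) = [set 0].
Proof.
apply: lie_center_eq0 => u uC; apply: holo_rho_inj; apply: derP => x.
  have := uC (holo_iota1 x); rewrite holo_iota1_rho => /(congr1 fst) /= ->.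
  by rewrite /holo_rho1 raddf0 add0r.
have := uC (holo_iota2 x); rewrite holo_iota2_rho => /(congr1 fst) /=.
by move=> /eqP; rewrite oppr_eq0 => /eqP ->.
Qed.

(** Bracketing with the pair [(delta, 0)] preserves the fibre product: [[lie delta, holo_rho1 u]] is
    inner, hence congruent to [0] modulo [ad L]. *)
Lemma holo_der_of_central (delta : Der L) :
  (forall d, [lie delta, d] \in inner L) ->
  exists D : Der (holomorph L), forall u,
    holo_rho1 (D u) = [lie delta, holo_rho1 u] /\ (D u).2 = 0.
Proof.
move=> delta_central.
have /choice[f fE] (u : holomorph L) : exists y, [lie delta, holo_rho1 u] = ad y.
  exact/asboolP/delta_central.
pose D u := holo_iota1 (f u).
have rhoD u : holo_rho1 (D u) = [lie delta, holo_rho1 u].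
  by rewrite fE /holo_rho1 addr0.
have rhoP a (u v : holomorph L) :
    holo_rho1 (a *: u + v) = a *: holo_rho1 u + holo_rho1 v.
  by rewrite /holo_rho1 linearP /= scalerDr addrACA.
have D_der : D \in derivation (holomorph L).
  apply/asboolP; split=> [a u v|u v]; apply: holo_rho_inj.
  - by rewrite rhoD !rhoP !rhoD liebDr liebZr.
  - by rewrite /= scaler0 addr0.
  (* The coefficient [1] brings the sum into the form [a *: u + v] of [rhoP]. *)
  - rewrite -[[lie D u, v]]scale1r rhoP scale1r rhoD !holo_rho1M !rhoD.
    exact: lieb_leibniz.
  - by rewrite /= lie0b lieb0 addr0.
by exists (MkDer D_der) => u; split; first exact: rhoD.
Qed.

End Holomorph.

(** * The center of [OutDer L] in terms of representatives *)

Lemma pi_lie_quot_eq0 (F : fieldType) (L : lieAlgType F) (I : lieIdeal L)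
    (x : L) : (\pi_(lie_quot I) x = 0 :> lie_quot I) <-> x \in I.
Proof.
have pi0 : \pi_(lie_quot I) (0 : L) = 0 :> lie_quot I by exact: raddf0.
rewrite -pi0 -[x in x \in _]subr0 Quotient.idealrBE.
exact: (rwP eqP).
Qed.

Section OutDer.
Variables (F : fieldType) (L : lieAlgType F).

Lemma pi_OutDer_eq0 (d : Der L) :
  (\pi_(OutDer L) d = 0 :> OutDer L) <-> d \in inner L.
Proof. exact: (pi_lie_quot_eq0 (inner L)). Qed.

Lemma pi_OutDerM (d e : Der L) :
  [lie (\pi_(OutDer L) d : OutDer L), \pi_(OutDer L) e]
    = \pi_(OutDer L) [lie d, e].
Proof. exact: quot_liebE. Qed.

Lemma pi_OutDer_central (d : Der L) :
  lie_center (OutDer L) (\pi_(OutDer L) d) <->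
  forall e, [lie d, e] \in inner L.
Proof.
split=> [dC e|dC u]; first by apply/pi_OutDer_eq0; rewrite -pi_OutDerM dC.
by rewrite -(reprK u) pi_OutDerM; apply/pi_OutDer_eq0.
Qed.

Lemma lie_center_OutDer_eq0 :
  lie_center (OutDer L) = [set 0] <->
  forall d : Der L, (forall e, [lie d, e] \in inner L) -> d \in inner L.
Proof.
split=> [C0 d /pi_OutDer_central|H].
  by rewrite C0 => /pi_OutDer_eq0.
apply: lie_center_eq0 => u; rewrite -(reprK u) => uC.
exact/pi_OutDer_eq0/H/pi_OutDer_central.
Qed.

End OutDer.

Lemma lie_complete_holomorph (F : fieldType) (g : lieAlgType F) :
  lie_perfect g -> lie_center g = [set 0] ->
  lie_complete (holomorph g) <-> lie_center (OutDer g) = [set 0].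
Proof.
move=> g_perfect g_centerless; rewrite lie_center_OutDer_eq0; split.
  move=> [_ h_inner] delta /(holo_der_of_central g_centerless)[D DE].
  have /asboolP[[z e] Dze] := h_inner D.
  (* The second coordinate of [D] vanishes, so [e] commutes with every [d]. *)
  have e0 : e = 0.
    have : lie_center (Der g) e.
      by move=> d; have [_] := DE (0, d); rewrite Dze.
    by rewrite lie_center_Der.
  apply/asboolP; exists z; apply: derP => x; apply: (ad_inj g_centerless).
  have [] := DE (holo_iota1 x).
  by rewrite Dze e0 adE holo_rho1M /holo_rho1 /= !addr0 -adM lieb_ad => ->.
move=> central_inner; split; first exact: lie_center_holomorph.
move=> D; apply/asboolP.
have iota1_eq0 (x : g) : holo_iota1 x = 0 :> holomorph g -> x = 0.
  by move=> /(congr1 fst).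
have iota2_eq0 (x : g) : holo_iota2 x = 0 :> holomorph g -> x = 0.
  by move=> /(congr1 snd) /(ad_eq0 g_centerless).
have [d1 d1E] := der_perfect_ideal g_perfect iota1_eq0 (@holo_iota1M F g)
  (@holo_iota1_rho F g) D.
have [d2 d2E] := der_perfect_ideal g_perfect iota2_eq0 (@holo_iota2M F g)
  (@holo_iota2_rho F g) D.
have /asboolP[z zE] : d1 - d2 \in inner g.
  (* Both coordinates of [(0, d)] are [d], so those of its image are [[lie d1, d]] and
     [[lie d2, d]]; they differ by [ad] of its first component. *)
  apply: central_inner => d; apply/asboolP; exists (D (0, d)).1.
  have := d1E (0, d); rewrite {1 2}/holo_rho1 d2E /= raddf0 add0r liebBl => <-.
  by rewrite addrK.
(* The coordinates of [(z, d2)] are [ad z + d2 = d1] and [d2]. *)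
exists (z, d2); apply: derP => u; apply: holo_rho_inj => //.
by rewrite adE holo_rho1M d1E /holo_rho1 /= -zE subrK.
Qed.

Theorem theorem1p1 (F : fieldType) (g : lieAlgType F)
    (g_perfect : lie_perfect g) (g_centerless : lie_center g = [set 0]) :
  lie_complete (Der g) /\
  (lie_complete (holomorph g) <-> lie_center (OutDer g) = [set 0]).
Proof.
split; first exact: lie_complete_Der.
exact: lie_complete_holomorph.
Qed.
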